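(* Let $\dot x=X(x,y)$, $\dot y=Y(x,y)$ be a planar differential system, where $X,Y$ are real polynomials vanishing at the origin. Then every limit cycle of this system that is both star-like and reversible is algebraic.
   Context: Put $r=\sqrt{x^2+y^2}$, $R(x,y)=\big(xX(x,y)+yY(x,y)\big)/r$ and $T(x,y)=\big(xY(x,y)-yX(x,y)\big)/r^2$. In polar coordinates $x=r\cos\theta$, $y=r\sin\theta$, eliminating $t$, the system becomes $\frac{dr}{d\theta}=\frac{R(r\cos\theta,r\sin\theta)}{T(r\cos\theta,r\sin\theta)}$, which is well defined where $T\neq 0$. A periodic orbit of the system is called star-like if it does not intersect the set $\{T=0\}$; such an orbit corresponds to a smooth $2\pi$-periodic solution $r=F(\theta)$ of this polar equation. A limit cycle is a periodic orbit that is isolated in the set of periodic orbits. A limit cycle is called reversible if, after a translation and a rotation of the plane, it can be written as $(x(t),y(t))$ with $(x(t),y(t))=(-x(-t),y(-t))$ for all $t\in\mathbb{R}$. A limit cycle is called algebraic if it is contained in the zero set $\{G(x,y)=0\}$ of some (nonzero) real polynomial $G$ in two variables. *)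

(* Defs.v *)
From HB Require Import structures.
From mathcomp Require Import all_boot all_order all_algebra.
From mathcomp Require Import all_classical all_reals all_analysis.
From mathcomp Require Export polyXY.

Set Implicit Arguments.
Unset Strict Implicit.
Unset Printing Implicit Defensive.

Import Order.TTheory GRing.Theory Num.Theory.
Import numFieldNormedType.Exports.

Local Open Scope classical_set_scope.
Local Open Scope ring_scope.

(* Bivariate polynomials are elements P of {poly {poly R}}; polyXY's
   P.[a, b] = P.[a%:P].[b] is the value P(a, b): the outer indeterminate is x
   and the inner one is y. *)

Definition vanishes_at_origin (R : realType) (P : {poly {poly R}}) : Prop :=
  P.[0, 0] = 0.

Definition solution (R : realType) (X Y : {poly {poly R}}) (x y : R -> R) :
    Prop :=
  forall t : R, is_derive t 1 x (X.[x t, y t]) /\ is_derive t 1 y (Y.[x t, y t]).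

Definition trajectory (R : realType) (x y : R -> R) : set (R * R) :=
  range (fun t => (x t, y t)).

(* Equilibria are excluded. *)
Definition periodic_orbit (R : realType) (X Y : {poly {poly R}})
    (C : set (R * R)) : Prop :=
  exists x y : R -> R,
    [/\ solution X Y x y,
        exists2 P : R, 0 < P & periodic x P /\ periodic y P,
        exists t, (x t, y t) <> (x 0, y 0)
      & C = trajectory x y].

Definition limit_cycle (R : realType) (X Y : {poly {poly R}})
    (C : set (R * R)) : Prop :=
  periodic_orbit X Y C /\
  exists U : set (R * R),
    [/\ open U, C `<=` U
      & forall C', periodic_orbit X Y C' -> C' `<=` U -> C' = C].

Definition radius (R : realType) (p : R * R) : R :=
  Num.sqrt (p.1 ^+ 2 + p.2 ^+ 2).

(* As division by 0 gives 0, this is 0 at the origin, where the quotient is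
   undefined.  This is harmless: when X and Y vanish at the origin, no periodic
   orbit passes through it. *)
Definition angular_speed (R : realType) (X Y : {poly {poly R}}) (p : R * R) :
    R :=
  (p.1 * Y.[p.1, p.2] - p.2 * X.[p.1, p.2]) / radius p ^+ 2.

Definition star_like (R : realType) (X Y : {poly {poly R}})
    (C : set (R * R)) : Prop :=
  C `&` [set p | angular_speed X Y p = 0] = set0.

Definition translation (R : realType) (c p : R * R) : R * R :=
  (p.1 + c.1, p.2 + c.2).

Definition rotation (R : realType) (phi : R) (p : R * R) : R * R :=
  (cos phi * p.1 - sin phi * p.2, sin phi * p.1 + cos phi * p.2).

(* The symmetry concerns the time parametrization by a solution of the system,
   not just the curve C as a set. *)
Definition reversible (R : realType) (X Y : {poly {poly R}})
    (C : set (R * R)) : Prop :=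
  exists (x y : R -> R) (c : R * R) (phi : R),
    [/\ solution X Y x y, C = trajectory x y
      & let g t := rotation phi (translation c (x t, y t)) in
        forall t, g t = (- (g (- t)).1, (g (- t)).2)].

Definition algebraic_curve (R : realType) (C : set (R * R)) : Prop :=
  exists G : {poly {poly R}},
    G != 0 /\ C `<=` [set p | G.[p.1, p.2] = 0].

(* Main.v *)
From mathcomp Require Import all_boot all_order all_algebra.
From mathcomp Require Import all_classical all_reals all_analysis.
From mathcomp Require Import ring lra.
Require Import Defs.

Set Implicit Arguments.
Unset Strict Implicit.
Unset Printing Implicit Defensive.

Import Order.TTheory GRing.Theory Num.Theory.
Import numFieldNormedType.Exports.

Local Open Scope classical_set_scope.
Local Open Scope ring_scope.

(** In coordinates adapted to the reversing symmetry, the cycle is a solution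
    (u, v) of a polynomial system u' = P, v' = Q, with u odd and v even in t.
    Differentiating these two relations shows that the polynomials
    P(-a, b) - P(a, b) and Q(-a, b) + Q(a, b) vanish along the cycle.  If one of
    them is nonzero, it exhibits the cycle as algebraic.

    Otherwise the whole system is invariant under the reflection of a combined
    with the reversal of time, and then a symmetric closed orbit is never
    isolated.  By uniqueness, any solution that starts on the axis a = 0 is
    symmetric about that time, and a solution that meets the axis at the times 0
    and tau is symmetric about both, hence 2 tau-periodic
    (two_crossings_periodic).  The cycle passes from one side of the axis to the
    other, so solutions starting close to it on the axis return to the axis and
    are closed, and they stay close to it (nearby_symmetric_orbits).  They are
    different from the cycle, because the cycle crosses the axis transversally
    and so has only isolated points there (orbit_misses_nearby_axis_points).

    The argument rests on existence, uniqueness and continuous dependence for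
    ordinary differential equations.  These are proved for bounded fields that
    are Lipschitz for a sup norm (integral_curve_exists,
    integral_curve_unique, integral_curve_dependence), by Picard iteration with
    the weight e^(c|t|), under which the integral operator contracts on the
    whole real line.  They apply to a polynomial field once its arguments are
    cut off to a large box, and nothing changes for the solutions that stay in
    that box. *)

(** * Increments and primitives of real functions *)

Lemma is_derive_continuous (R : realType) (g dg : R -> R) :
  (forall t : R, is_derive t 1 g (dg t)) -> continuous g.
Proof. by move=> dgP t; exact/differentiable_continuous/derivable1_diffP. Qed.

Lemma is_derive_comp_opp (R : realType) (g dg : R -> R) :
  (forall t : R, is_derive t 1 g (dg t)) ->
  forall t : R, is_derive t 1 (fun t => g (- t)) (- dg (- t)).
Proof.
move=> dgP t; rewrite -mulrN1.
exact: (@is_derive1_comp _ g -%R).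
Qed.

Lemma is_derive_comp_shift (R : realType) (g dg : R -> R) (s : R) :
  (forall t : R, is_derive t 1 g (dg t)) ->
  forall t : R, is_derive t 1 (fun t => g (s + t)) (dg (s + t)).
Proof.
move=> dgP t; rewrite -[dg _]mulr1.
have dP : is_derive t 1 (fun t : R => s + t) 1.
  by apply: is_derive_eq; rewrite add0r mulr1.
exact: (@is_derive1_comp _ g (fun t => s + t)).
Qed.

Lemma ler_increment (R : realType) (g dg h dh : R -> R) :
  (forall t : R, is_derive t 1 g (dg t)) -> (forall t : R, is_derive t 1 h (dh t)) ->
  (forall t, 0 <= t -> `|dg t| <= dh t) ->
  forall t, 0 <= t -> `|g t - g 0| <= h t - h 0.
Proof.
move=> dgP dhP dgh t t0.
have mono (e : R) : `|e| = 1 -> e * (g t - g 0) <= h t - h 0.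
  move=> e1.
  have dP (s : R) : is_derive s 1 (fun s => h s - e * g s) (dh s - e * dg s).
    by apply: is_derive_eq; rewrite /GRing.scale/=; ring.
  have [|c] := MVT_segment t0 (fun s _ => dP s).
    exact: continuous_subspaceT (is_derive_continuous dP).
  rewrite in_itv/= => /andP[c0 _] eqD.
  suff : 0 <= (dh c - e * dg c) * (t - 0) by rewrite -eqD; lra.
  rewrite mulr_ge0 ?subr_ge0 //; apply: le_trans (dgh _ c0).
  by apply: le_trans (ler_norm _) _; rewrite normrM e1 mul1r.
rewrite ler_norml; apply/andP; split; last by have := mono 1 (normr1 _); lra.
by have := mono (-1) (normrN1 _); lra.
Qed.

(** The weight e^(c|t|) reproduces itself up to the factor 1/c when integrated
    from 0.  Measuring functions against it turns the integral operator of an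
    initial value problem into a contraction on the whole line at once, so that
    no local solutions have to be glued. *)
Lemma weighted_increment (R : realType) (g dg : R -> R) (c K : R) :
  0 < c -> 0 <= K -> (forall t : R, is_derive t 1 g (dg t)) ->
  (forall t, `|dg t| <= K * expR (c * `|t|)) ->
  forall t, `|g t - g 0| <= K / c * expR (c * `|t|).
Proof.
move=> c0 K0.
have pos (k dk : R -> R) : (forall t : R, is_derive t 1 k (dk t)) ->
    (forall t, `|dk t| <= K * expR (c * `|t|)) ->
    forall t, 0 <= t -> `|k t - k 0| <= K / c * expR (c * t).
  move=> dkP dkle t t0.
  have dhP (s : R) : is_derive s 1 (fun s => K / c * expR (c * s)) (K * expR (c * s)).
    apply: is_derive_eq; rewrite /GRing.scale/=; field; exact: lt0r_neq0.
  apply: le_trans (ler_increment dkP dhP _ t0) _.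
    by move=> s s0; rewrite -{2}(ger0_norm s0).
  by rewrite gerBl mulr_ge0 ?expR_ge0// divr_ge0// ltW.
move=> dgP dgle t; have [t0|t0] := leP 0 t.
  by rewrite (ger0_norm t0); exact: (pos _ _ dgP).
rewrite (ltr0_norm t0) -[in g t](opprK t) -[in g 0]oppr0.
apply: (pos (fun s => g (- s)) _ (is_derive_comp_opp dgP)) => [s|]; last by rewrite oppr_ge0 ltW.
by rewrite normrN -(normrN s); exact: dgle.
Qed.

Lemma bounded_derive_lipschitz (R : realType) (g dg : R -> R) (B : R) :
  (forall t : R, is_derive t 1 g (dg t)) -> (forall t, `|dg t| <= B) ->
  forall t s, `|g t - g s| <= B * `|t - s|.
Proof.
move=> dgP dgB t s; wlog st : t s / s <= t.
  move=> H; have [/H//|/ltW/H] := leP s t.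
  by rewrite distrC (distrC s).
have [|c _ ->] := MVT_segment st (fun s _ => dgP s).
  exact: continuous_subspaceT (is_derive_continuous dgP).
by rewrite normrM ler_wpM2r.
Qed.

Lemma lipschitz_continuous (R : realType) (g : R -> R) (B : R) :
  (forall t s, `|g t - g s| <= B * `|t - s|) -> continuous g.
Proof.
move=> gB t; apply/cvgrPdist_lt => e e0.
have B0 : 0 <= B.
  by have := le_trans (normr_ge0 _) (gB 1 0); rewrite subr0 normr1 mulr1.
have B1 : 0 < B + 1 by lra.
near=> s; apply: le_lt_trans (gB _ _) _.
apply: (@le_lt_trans _ _ ((B + 1) * `|t - s|)); first by rewrite ler_wpM2r//; lra.
rewrite mulrC -ltr_pdivlMr//; near: s.
by apply: (nbhsx_ballx t (e / (B + 1))); rewrite divr_gt0.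
Unshelve. all: by end_near. Qed.

(** The fundamental theorem of calculus gives a primitive to the right of any
    base point; two base points give the same primitive once it is normalized
    at 0, so a base point may be chosen separately for each argument. *)
Lemma continuous_primitive (R : realType) (f : R -> R) : continuous f ->
  exists2 F : R -> R, F 0 = 0 & forall t : R, is_derive t 1 F (f t).
Proof.
move=> cf.
have intf a u : (@lebesgue_measure R).-integrable `[a, u] (EFin \o f).
  apply: continuous_compact_integrable; first exact: segment_compact.
  exact: continuous_subspaceT.
pose G a x := (\int[lebesgue_measure]_(t in `[a, x]) f t)%R.
have GP (a x : R) : a < x -> is_derive x 1 (G a) (f x).
  move=> ax; have x1 : x < x + 1 by rewrite ltrDl.
  have [] := continuous_FTC1_closed x1 (intf a _) ax (cf x).
  by move=> dG <-; rewrite derive1E; exact/derivableP.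
have Gsub (a b x : R) : a < b -> b < x -> G a x - G a b = G b x.
  move=> ab bx; rewrite /G Rintegral_itvB ?bnd_simp; [|exact: intf|exact: ltW..].
  apply: Rintegral_itv_obnd_cbnd; apply: integrableS (intf b x) => //.
  exact: subset_itv_oc_cc.
pose H a x := G a x - G a 0.
have HE (a b x : R) : a < b -> b < x -> b < 0 -> H a x = H b x.
  by move=> ab bx b0; rewrite /H -(Gsub a b x)// -(Gsub a b 0)//; ring.
(* A base point to the left of both x and 0. *)
pose base (x : R) : R := - `|x| - 1.
exists (fun x => H (base x) x) => [|t]; first by rewrite /H subrr.
have baselt x : base x < x by rewrite /base; have := ler_norm (- x); rewrite normrN; lra.
apply: (@near_eq_is_derive _ _ _ (H (base t - 1))); last first.
  have dG : is_derive t 1 (G (base t - 1)) (f t).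
    by apply: GP; have := baselt t; lra.
  by apply: is_derive_eq; rewrite subr0.
near=> s.
have st : `|t - s| < 1.
  by near: s; exact: (nbhsx_ballx t 1).
have := lerB_dist s t; rewrite distrC => h.
rewrite (HE _ (base s))//; rewrite /base; have := normr_ge0 s; lra.
Unshelve. all: by end_near. Qed.

Lemma isolated_value (R : realType) (f : R -> R) (t d : R) :
  is_derive t 1 f d -> d != 0 -> \forall s \near t, f s = f t -> s = t.
Proof.
move=> /is_derive1_caratheodory[g [gE gC gt]] d0.
have ng : \forall s \near t, g s != 0 by apply: cvgr_neq0 gC _; rewrite gt.
near=> s => fs; apply/eqP; rewrite -subr_eq0.
have : g s * (s - t) == 0 by rewrite -gE fs subrr.
rewrite mulf_eq0 => /orP[/eqP gs|//].
have : g s != 0 by near: s; exact: ng.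
by rewrite gs eqxx.
Unshelve. all: by end_near. Qed.

(** * Geometric convergence *)

Lemma ler_geometric_limit (R : realType) (x a b : R) :
  (forall n : nat, x <= a + b / 2 ^+ n) -> x <= a.
Proof.
move=> xab; have [//|ax] := leP x a.
have d0 : 0 < x - a by lra.
pose n := (Num.truncn (b / (x - a))).+1.
have : b / (x - a) < 2 ^+ n.
  apply: lt_le_trans (truncnS_gt _) _; rewrite -natrX ler_nat.
  exact/ltnW/ltn_expl.
rewrite ltr_pdivrMr// mulrC -ltr_pdivrMr ?exprn_gt0//.
by have := xab n; lra.
Qed.

(** The intervals of radius 2 C / 2^n around u n are nested. *)
Lemma geometric_cauchy (R : realType) (u : nat -> R) (C : R) :
  (forall n, `|u n - u n.+1| <= C / 2 ^+ n) ->
  exists l, forall n, `|u n - l| <= 2 * C / 2 ^+ n.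
Proof.
move=> uC; pose e n : R := 2 * C / 2 ^+ n.
have eS n : e n = e n.+1 + C / 2 ^+ n.
  rewrite /e exprS; field; exact/expf_neq0/lt0r_neq0.
have e0 n : 0 <= e n.
  have := le_trans (normr_ge0 _) (uC n); rewrite /e -mulrA; lra.
have lo n k : u n - e n <= u (n + k)%N - e (n + k)%N.
  elim: k => [|k IH]; first by rewrite addn0.
  apply: le_trans IH _; rewrite addnS (eS (n + k)%N).
  by have := uC (n + k)%N; rewrite ler_norml; lra.
have hi n k : u (n + k)%N + e (n + k)%N <= u n + e n.
  elim: k => [|k IH]; first by rewrite addn0.
  apply: le_trans _ IH; rewrite addnS (eS (n + k)%N).
  by have := uC (n + k)%N; rewrite ler_norml; lra.
have lohi m n : u m - e m <= u n + e n.
  apply: le_trans (lo m n) (le_trans _ (hi n m)); rewrite [(n + m)%N]addnC.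
  by have := e0 (m + n)%N; lra.
pose A := range (fun n => u n - e n).
have A0 : A !=set0 by exists (u 0%N - e 0%N); exists 0%N.
have ubA n : ubound A (u n + e n) by move=> _ [m _ <-].
exists (sup A) => n; rewrite ler_norml -/(e n).
have := ge_sup A0 (ubA n).
have : u n - e n <= sup A.
  by apply: ub_le_sup; [exists (u 0%N + e 0%N) | exists n].
by lra.
Qed.

(** * Bounded Lipschitz differential equations *)

(** This is the Lipschitz condition for the sup norm on I -> R, stated without
    the norm, so that it makes sense for any index type I. *)
Definition sup_lipschitz (R : realType) (I : Type) (L : R)
    (f : I -> (I -> R) -> R) : Prop :=
  forall K p q, (forall j, `|p j - q j| <= K) ->
    forall i, `|f i p - f i q| <= L * K.

Definition integral_curve (R : realType) (I : Type)
    (f : I -> (I -> R) -> R) (z : I -> R -> R) : Prop :=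
  forall i (t : R), is_derive t 1 (z i) (f i (z^~ t)).

Definition weighted_close (R : realType) (I : Type) (c K : R)
    (z w : I -> R -> R) : Prop :=
  forall i t, `|z i t - w i t| <= K * expR (c * `|t|).

Lemma weight_ge1 (R : realType) (c t : R) : 0 < c -> 1 <= expR (c * `|t|).
Proof.
move=> c0; apply: le_trans (expR_ge1Dx _).
by rewrite lerDl mulr_ge0// ltW.
Qed.

Lemma normr_le_weight (R : realType) (c t : R) : 0 < c ->
  `|t| <= c^-1 * expR (c * `|t|).
Proof.
move=> c0; rewrite -(ler_pM2l c0) mulrA divff ?lt0r_neq0// mul1r.
by apply: le_trans (expR_ge1Dx _); rewrite lerDr.
Qed.

(** With the weight exponent 2 L, integration gains 1 / (2 L) and the field
    loses L, which leaves the factor 1 / 2. *)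
Lemma primitive_contraction (R : realType) (I : Type) (L delta K : R)
    (f : I -> (I -> R) -> R) (z w Z W : I -> R -> R) :
  0 < L -> sup_lipschitz L f -> 0 <= K ->
  (forall i (t : R), is_derive t 1 (Z i) (f i (z^~ t))) ->
  (forall i (t : R), is_derive t 1 (W i) (f i (w^~ t))) ->
  (forall i, `|Z i 0 - W i 0| <= delta) ->
  weighted_close (2 * L) K z w ->
  weighted_close (2 * L) (delta + K / 2) Z W.
Proof.
move=> L0 fL K0 dZ dW ZW0 zw i t.
have c0 : 0 < 2 * L by lra.
have dZW (s : R) : is_derive s 1 (fun s => Z i s - W i s)
    (f i (z^~ s) - f i (w^~ s)).
  by have := dW i s; have := dZ i s; exact: is_deriveB.
have dle (s : R) :
    `|f i (z^~ s) - f i (w^~ s)| <= L * K * expR (2 * L * `|s|).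
  by rewrite -mulrA; apply: fL => j; exact: zw.
have := weighted_increment c0 (mulr_ge0 (ltW L0) K0) dZW dle t.
have -> : L * K / (2 * L) = K / 2 by field; exact: lt0r_neq0.
have : delta <= delta * expR (2 * L * `|t|).
  by rewrite ler_peMr ?weight_ge1//; exact: le_trans (normr_ge0 _) (ZW0 i).
by have := ZW0 i; rewrite mulrDl !ler_norml; lra.
Qed.

(** Two integral curves of a bounded field separate at most linearly, hence
    they are weighted close with some constant K.  The contraction improves K to
    delta + K / 2, whose fixed point is 2 * delta. *)
Lemma integral_curve_dependence (R : realType) (I : Type) (L B delta : R)
    (f : I -> (I -> R) -> R) (z w : I -> R -> R) :
  0 < L -> sup_lipschitz L f -> (forall i p, `|f i p| <= B) ->
  integral_curve f z -> integral_curve f w ->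
  (forall i, `|z i 0 - w i 0| <= delta) ->
  weighted_close (2 * L) (2 * delta) z w.
Proof.
move=> L0 fL fB zP wP zw0 i t.
have c0 : 0 < 2 * L by lra.
have B0 : 0 <= B by exact: le_trans (normr_ge0 _) (fB i (fun=> 0)).
have d0 : 0 <= delta by exact: le_trans (normr_ge0 _) (zw0 i).
pose K0 := delta + 2 * B / (2 * L).
have K00 : 0 <= K0 by rewrite addr_ge0// divr_ge0 ?mulr_ge0// ltW.
have close0 : weighted_close (2 * L) K0 z w.
  move=> j s; rewrite mulrDl.
  have h1 := weight_ge1 s c0; have h2 := normr_le_weight s c0.
  have h3 := bounded_derive_lipschitz (zP j) (fun s => fB j _) s 0.
  have h4 := bounded_derive_lipschitz (wP j) (fun s => fB j _) s 0.
  rewrite subr0 in h3 h4.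
  have h5 : B * `|s| <= B * ((2 * L)^-1 * expR (2 * L * `|s|)).
    by rewrite ler_wpM2l.
  have h6 : delta <= delta * expR (2 * L * `|s|) by rewrite ler_peMr.
  move: (zw0 j) h3 h4 h5 h6; rewrite !ler_norml -!mulrA; lra.
have close n : weighted_close (2 * L) (2 * delta + K0 / 2 ^+ n) z w.
  elim: n => [|n IH].
    move=> j s; apply: le_trans (close0 j s) _.
    by rewrite ler_wpM2r ?expR_ge0// expr0; lra.
  have K_ge0 : 0 <= 2 * delta + K0 / 2 ^+ n.
    by rewrite addr_ge0 ?mulr_ge0// divr_ge0// exprn_ge0.
  have -> : 2 * delta + K0 / 2 ^+ n.+1 = delta + (2 * delta + K0 / 2 ^+ n) / 2.
    by rewrite exprS; field; exact/expf_neq0/lt0r_neq0.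
  exact: primitive_contraction zP wP zw0 IH.
apply: (@ler_geometric_limit _ _ _ (K0 * expR (2 * L * `|t|))) => n.
by apply: le_trans (close n i t) _; rewrite mulrDl [X in _ + X]mulrAC.
Qed.

Lemma integral_curve_unique (R : realType) (I : Type) (L B : R)
    (f : I -> (I -> R) -> R) (z w : I -> R -> R) :
  0 < L -> sup_lipschitz L f -> (forall i p, `|f i p| <= B) ->
  integral_curve f z -> integral_curve f w ->
  (forall i, z i 0 = w i 0) -> z = w.
Proof.
move=> L0 fL fB zP wP zw0; apply/funext => i; apply/funext => t.
have zw j : `|z j 0 - w j 0| <= 0 by rewrite zw0 subrr normr0.
have := integral_curve_dependence L0 fL fB zP wP zw i t.
by rewrite mulr0 mul0r normr_le0 subr_eq0 => /eqP.
Qed.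

(** Picard iteration.  All iterates inherit the Lipschitz constant B in time,
    which is what makes the right-hand side continuous, and thus integrable, for
    any index type I. *)
Theorem integral_curve_exists (R : realType) (I : Type) (L B : R)
    (f : I -> (I -> R) -> R) (p : I -> R) :
  0 < L -> sup_lipschitz L f -> (forall i p, `|f i p| <= B) ->
  exists2 z, integral_curve f z & forall i, z i 0 = p i.
Proof.
move=> L0 fL fB.
have [iota0|/existsNP[i0 _]] := pselect (I -> False).
  by exists (fun _ _ => 0) => i; case: (iota0 i).
have B0 : 0 <= B by exact: le_trans (normr_ge0 _) (fB i0 (fun=> 0)).
have c0 : 0 < 2 * L by lra.
have /choice[prim primP] (g : R -> R) : exists F : R -> R,
    continuous g -> F 0 = 0 /\ forall t : R, is_derive t 1 F (g t).
  have [/continuous_primitive[F F0 FP]|ncg] := pselect (continuous g).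
    by exists F.
  by exists (fun=> 0).
pose T (z : I -> R -> R) i t := p i + prim (fun s => f i (z^~ s)) t.
pose slow (z : I -> R -> R) := forall i t s, `|z i t - z i s| <= B * `|t - s|.
have cont_f z i : slow z -> continuous (fun s => f i (z^~ s)).
  move=> zB; apply: (@lipschitz_continuous _ _ (L * B)) => t s.
  by rewrite -mulrA; apply: fL => j; exact: zB.
have T0 z i : slow z -> T z i 0 = p i.
  by move=> /cont_f zB; rewrite /T (primP _ (zB i)).1 addr0.
have dT z : slow z -> forall i (t : R), is_derive t 1 (T z i) (f i (z^~ t)).
  move=> /cont_f zB i t; have dP := (primP _ (zB i)).2 t.
  by rewrite -[f i _]add0r; exact: (@is_deriveD _ _ _ (cst (p i))).
have slowT z : slow z -> slow (T z).
  move=> zB i; apply: (bounded_derive_lipschitz (dT z zB i)) => t; exact: fB.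
pose x n := iter n T (fun i _ => p i).
have slowx n : slow (x n).
  elim: n => [i t s|n IH]; last exact: slowT.
  by rewrite /= subrr normr0 mulr_ge0.
pose K0 := B / (2 * L).
have K00 : 0 <= K0 by rewrite divr_ge0// ltW.
have geo0 (K : R) n : 0 <= K -> 0 <= K / 2 ^+ n.
  by move=> K_ge0; rewrite divr_ge0// exprn_ge0.
have contract z w K : slow z -> slow w -> 0 <= K -> weighted_close (2 * L) K z w ->
    weighted_close (2 * L) (K / 2) (T z) (T w).
  move=> zB wB K_ge0 zw; rewrite -[K / 2]add0r.
  apply: (primitive_contraction L0 fL K_ge0 (dT z zB) (dT w wB)) => // i.
  by rewrite !T0// subrr normr0.
have halve (K : R) n : K / 2 ^+ n.+1 = K / 2 ^+ n / 2.
  by rewrite exprS invfM [_^-1 * _]mulrC mulrA.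
have step n : weighted_close (2 * L) (K0 / 2 ^+ n) (x n) (x n.+1).
  elim: n => [i t|n IH].
    rewrite expr0 divr1 distrC -[X in _ - X](T0 _ i (slowx 0%N)).
    apply: le_trans (slowx 1%N i t 0) _; rewrite subr0 /K0 -mulrA.
    by rewrite ler_wpM2l// normr_le_weight.
  by rewrite halve; exact: contract (slowx n) (slowx n.+1) (geo0 _ n K00) IH.
have /choice[z zP] i : exists zi : R -> R, forall t n,
    `|x n i t - zi t| <= 2 * K0 / 2 ^+ n * expR (2 * L * `|t|).
  have /choice[zi ziP] (t : R) : exists l, forall n,
      `|x n i t - l| <= 2 * K0 / 2 ^+ n * expR (2 * L * `|t|).
    have [|l lP] := @geometric_cauchy _ (fun n => x n i t)
      (K0 * expR (2 * L * `|t|)).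
      by move=> n; rewrite mulrAC; exact: step.
    exists l => n; apply: le_trans (lP n) _.
    by rewrite mulrA mulrAC.
  by exists zi.
have xz n : weighted_close (2 * L) (2 * K0 / 2 ^+ n) (x n) z by move=> i t.
have slowz : slow z.
  move=> i t s; apply: (@ler_geometric_limit _ _ _
    (2 * K0 * (expR (2 * L * `|t|) + expR (2 * L * `|s|)))) => n.
  have := xz n i t; have := xz n i s; have := slowx n i t s.
  by rewrite mulrAC mulrDr !ler_norml; lra.
have Tz : T z = z.
  apply/funext => i; apply/funext => t; apply/eqP.
  rewrite -subr_eq0 -normr_le0.
  apply: (@ler_geometric_limit _ _ _ (2 * K0 * expR (2 * L * `|t|))) => n.
  have := xz n.+1 i t; rewrite halve.
  have K_ge0 : 0 <= 2 * K0 / 2 ^+ n by rewrite geo0// mulr_ge0.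
  have := contract _ _ _ (slowx n) slowz K_ge0 (xz n) i t.
  by rewrite add0r [X in _ -> _ -> _ <= X]mulrAC /= !ler_norml; lra.
exists z => i; last by rewrite -[in LHS]Tz T0.
by move=> t; have := dT z slowz i t; rewrite Tz.
Qed.

(** * Bivariate polynomials *)

Lemma horner2_comp (R : realType) (P A B : {poly {poly R}}) :
  exists Z : {poly {poly R}}, forall x y, Z.[x, y] = P.[A.[x, y], B.[x, y]].
Proof.
have inner (q : {poly R}) :
    exists Z : {poly {poly R}}, forall x y, Z.[x, y] = q.[B.[x, y]].
  elim/poly_ind: q => [|q c [Z ZP]].
    by exists 0 => x y; rewrite !horner0.
  by exists (Z * B + c%:P%:P) => x y; rewrite !hornerE ZP.
elim/poly_ind: P => [|P c [Z ZP]].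
  by exists 0 => x y; rewrite !horner0.
have [W WP] := inner c.
by exists (Z * A + W) => x y; rewrite !hornerE ZP WP.
Qed.

Lemma horner2_box_lipschitz (R : realType) (P : {poly {poly R}}) (M : R) :
  0 <= M ->
  exists2 K, 0 <= K & forall a b a' b' d,
    `|a| <= M -> `|b| <= M -> `|a'| <= M -> `|b'| <= M ->
    `|a - a'| <= d -> `|b - b'| <= d ->
    `|P.[a, b]| <= K /\ `|P.[a, b] - P.[a', b']| <= K * d.
Proof.
move=> M0.
(* One constant serves both as a bound and as a Lipschitz constant, so that the
   class of such functions is visibly stable under products. *)
pose good (g : R -> R -> R) := exists2 K, 0 <= K & forall a b a' b' d,
    `|a| <= M -> `|b| <= M -> `|a'| <= M -> `|b'| <= M ->
    `|a - a'| <= d -> `|b - b'| <= d ->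
    `|g a b| <= K /\ `|g a b - g a' b'| <= K * d.
have ext g h : (forall a b, g a b = h a b) -> good g -> good h.
  move=> gh [K K0 KP]; exists K => // a b a' b' d *.
  by rewrite -!gh; exact: KP.
have cstP c : good (fun _ _ => c).
  exists `|c| => // a b a' b' d _ _ _ _ ad _; split=> //.
  by rewrite subrr normr0 mulr_ge0//; exact: le_trans (normr_ge0 _) ad.
have fstP : good (fun a _ => a).
  exists (M + 1) => [|a b a' b' d aM _ _ _ ad _]; first by lra.
  split; first by lra.
  by apply: (le_trans ad); rewrite ler_peMl//; [exact: le_trans (normr_ge0 _) ad | lra].
have sndP : good (fun _ b => b).
  exists (M + 1) => [|a b a' b' d _ bM _ _ _ bd]; first by lra.
  split; first by lra.
  by apply: (le_trans bd); rewrite ler_peMl//; [exact: le_trans (normr_ge0 _) bd | lra].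
have addP g h : good g -> good h -> good (fun a b => g a b + h a b).
  move=> [K K0 KP] [K' K'0 K'P]; exists (K + K'); first exact: addr_ge0.
  move=> a b a' b' d aM bM a'M b'M ad bd.
  have [] := KP _ _ _ _ _ aM bM a'M b'M ad bd.
  have [] := K'P _ _ _ _ _ aM bM a'M b'M ad bd.
  by rewrite mulrDl !ler_norml; split; lra.
have mulP g h : good g -> good h -> good (fun a b => g a b * h a b).
  move=> [K K0 KP] [K' K'0 K'P]; exists (2 * K * K'); first by rewrite !mulr_ge0.
  move=> a b a' b' d aM bM a'M b'M ad bd.
  have [gK gKd] := KP _ _ _ _ _ aM bM a'M b'M ad bd.
  have [hK hKd] := K'P _ _ _ _ _ aM bM a'M b'M ad bd.
  have [|| h'K _] := K'P _ _ _ _ 0 a'M b'M a'M b'M; rewrite ?subrr ?normr0//.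
  split.
    rewrite normrM; apply: le_trans (ler_pM _ _ gK hK) _ => //.
    by rewrite -mulrA ler_peMl ?mulr_ge0//; lra.
  have -> : g a b * h a b - g a' b' * h a' b' =
    g a b * (h a b - h a' b') + (g a b - g a' b') * h a' b' by ring.
  apply: le_trans (ler_normD _ _) _; rewrite !normrM.
  have -> : 2 * K * K' * d = K * (K' * d) + K * d * K' by ring.
  by apply: lerD; exact: ler_pM.
have inner (q : {poly R}) : good (fun _ b => q.[b]).
  elim/poly_ind: q => [|q c IH].
    by apply: (ext (fun _ _ => 0)) (cstP 0) => a b; rewrite horner0.
  apply: (ext (fun _ b => q.[b] * b + c)); last exact: addP (mulP _ _ IH _) _.
  by move=> a b; rewrite !hornerE.
elim/poly_ind: P => [|P q IH].
  by apply: (ext (fun _ _ => 0)) (cstP 0) => a b; rewrite !horner0.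
apply: (ext (fun a b => P.[a, b] * a + q.[b])).
  by move=> a b; rewrite !hornerE.
by apply: addP (inner q); exact: mulP.
Qed.

Lemma horner2_affine (R : realType) (a b c : R) :
  exists Z : {poly {poly R}}, forall x y, Z.[x, y] = a * x + b * y + c.
Proof.
exists (a%:P%:P * 'X + (b%:P * 'X + c%:P)%:P) => x y.
by rewrite !(hornerD, hornerM, hornerC, hornerX) addrA.
Qed.

Lemma horner2_combination (R : realType) (a b : R) (P Q : {poly {poly R}}) :
  exists Z : {poly {poly R}}, forall x y,
    Z.[x, y] = a * P.[x, y] + b * Q.[x, y].
Proof. by exists (a%:P%:P * P + b%:P%:P * Q) => x y; rewrite !hornerE. Qed.

Lemma horner2_mirror (R : realType) (P : {poly {poly R}}) :
  exists Z : {poly {poly R}}, forall a b, Z.[a, b] = P.[- a, b].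
Proof.
have [A AP] := horner2_affine (-1 : R) 0 0.
have [B BP] := horner2_affine (0 : R) 1 0.
have [Z ZP] := horner2_comp P A B.
by exists Z => a b; rewrite ZP AP BP; congr (_.[_, _]); ring.
Qed.

(** * Polynomial systems cut off to a box *)

Definition clamp (R : realType) (M a : R) : R := Num.max (- M) (Num.min M a).

Lemma clamp_id (R : realType) (M a : R) : `|a| <= M -> clamp M a = a.
Proof.
by rewrite ler_norml => /andP[Ma aM]; rewrite /clamp (min_idPr aM) (max_idPr Ma).
Qed.

Lemma clampN (R : realType) (M a : R) : 0 <= M -> clamp M (- a) = - clamp M a.
Proof.
move=> M0; rewrite /clamp /Num.max /Num.min.
by repeat case: ifPn; rewrite -?leNgt => *; lra.
Qed.

Lemma normr_clamp (R : realType) (M a : R) : 0 <= M -> `|clamp M a| <= M.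
Proof.
move=> M0; rewrite /clamp /Num.max /Num.min.
by repeat case: ifPn; rewrite -?leNgt ler_norml => *; lra.
Qed.

Lemma clamp_dist (R : realType) (M a b : R) : 0 <= M ->
  `|clamp M a - clamp M b| <= `|a - b|.
Proof.
move=> M0; rewrite /clamp /Num.max /Num.min.
by have := ler_norm (a - b); have := ler_norm (b - a); rewrite distrC => ? ?;
  repeat case: ifPn; rewrite -?leNgt ler_norml => *; lra.
Qed.

(** Cutting the coordinates off at M makes a polynomial field globally Lipschitz
    and bounded, without changing it where the coordinates are at most M in
    absolute value.  As the cut-off is odd, it respects the symmetries of the
    field. *)
Definition clamped_field (R : realType) (M : R) (P Q : {poly {poly R}})
    (i : bool) (p : bool -> R) : R :=
  (if i then Q else P).[clamp M (p false), clamp M (p true)].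

Definition planar_curve (R : realType) (x y : R -> R) (i : bool) : R -> R :=
  if i then y else x.

Lemma clamped_field_regular (R : realType) (P Q : {poly {poly R}}) (M : R) :
  0 <= M -> exists L B,
    [/\ 0 < L, sup_lipschitz L (clamped_field M P Q)
      & forall i p, `|clamped_field M P Q i p| <= B].
Proof.
move=> M0.
have [K K0 KP] := horner2_box_lipschitz P M0.
have [K' K'0 K'P] := horner2_box_lipschitz Q M0.
exists (K + K' + 1), (K + K'); split=> [|d p q pq i|i p].
- by rewrite ltr_pwDr// addr_ge0.
- have d0 : 0 <= d by exact: le_trans (normr_ge0 _) (pq true).
  have close j : `|clamp M (p j) - clamp M (q j)| <= d.
    exact: le_trans (clamp_dist _ _ M0) (pq j).
  rewrite /clamped_field; case: i.
    have [//|//|//|//|||_ h] := K'P (clamp M (p false)) (clamp M (p true))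
      (clamp M (q false)) (clamp M (q true)) d; rewrite ?normr_clamp//.
    by apply: le_trans h _; rewrite ler_wpM2r//; lra.
  have [//|//|//|//|||_ h] := KP (clamp M (p false)) (clamp M (p true))
      (clamp M (q false)) (clamp M (q true)) d; rewrite ?normr_clamp//.
  by apply: le_trans h _; rewrite ler_wpM2r//; lra.
- rewrite /clamped_field; case: i.
    have [||||||h _] := K'P (clamp M (p false)) (clamp M (p true))
      (clamp M (p false)) (clamp M (p true)) 0;
      rewrite ?normr_clamp ?subrr ?normr0//.
    by apply: le_trans h _; lra.
  have [||||||h _] := KP (clamp M (p false)) (clamp M (p true))
      (clamp M (p false)) (clamp M (p true)) 0;
      rewrite ?normr_clamp ?subrr ?normr0//.
  by apply: le_trans h _; lra.
Qed.

Lemma solution_clamped_field (R : realType) (P Q : {poly {poly R}}) (M : R)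
    (x y : R -> R) : (forall t, `|x t| <= M) -> (forall t, `|y t| <= M) ->
  solution P Q x y <-> integral_curve (clamped_field M P Q) (planar_curve x y).
Proof.
move=> xM yM; split=> [sol i t|sol t].
  have [dx dy] := sol t.
  by case: i; rewrite /clamped_field /= !clamp_id.
have := sol false t; have := sol true t.
by rewrite /clamped_field /= !clamp_id.
Qed.

(** Both solutions live in a box where cutting off changes nothing. *)
Lemma bounded_solution_unique (R : realType) (P Q : {poly {poly R}}) (M : R)
    (x y x' y' : R -> R) :
  solution P Q x y -> (forall t, `|x t| <= M) -> (forall t, `|y t| <= M) ->
  solution P Q x' y' -> (forall t, `|x' t| <= M) -> (forall t, `|y' t| <= M) ->
  x 0 = x' 0 -> y 0 = y' 0 -> x = x' /\ y = y'.
Proof.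
move=> sol xM yM sol' x'M y'M x0 y0.
have M0 : 0 <= M by exact: le_trans (normr_ge0 _) (xM 0).
have [L [B [L0 fL fB]]] := clamped_field_regular P Q M0.
move/(solution_clamped_field _ _ xM yM) : sol => sol.
move/(solution_clamped_field _ _ x'M y'M) : sol' => sol'.
have eq0 i : planar_curve x y i 0 = planar_curve x' y' i 0 by case: i.
have eqz := integral_curve_unique L0 fL fB sol sol' eq0.
by split; [exact: (congr1 (fun z => z false) eqz)
          |exact: (congr1 (fun z => z true) eqz)].
Qed.

(** * Periodic functions and closed orbits *)

Lemma periodicz (R : realType) (f : R -> R) (p : R) (k : int) (t : R) :
  periodic f p -> f (t + p *~ k) = f t.
Proof.
move=> fp; case: k => n; first by rewrite -pmulrn periodicn.
rewrite NegzE mulrNz -pmulrn.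
by have := periodicn fp n.+1 (t - p *+ n.+1); rewrite subrK.
Qed.

(** The point s is the same for all f, so that both coordinates of an orbit are
    reduced to a period interval simultaneously. *)
Lemma periodic_reduce (R : realType) (p a t : R) : 0 < p ->
  exists2 s, a <= s <= a + p & forall f : R -> R, periodic f p -> f t = f s.
Proof.
move=> p0; pose k := Num.floor ((t - a) / p).
exists (t + p *~ - k) => [|f fp]; last by rewrite periodicz.
have := floor_le ((t - a) / p); have := floorD1_gt ((t - a) / p).
rewrite -/k mulrNz -mulrzr ltr_pdivrMr// ler_pdivlMr// intrD => h1 h2.
by lra.
Qed.

Lemma periodic_bounded (R : realType) (f : R -> R) (p : R) :
  continuous f -> 0 < p -> periodic f p -> exists M, forall t, `|f t| <= M.
Proof.
move=> cf p0 fp.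
have cnf : {within `[0, p], continuous (fun t => `|f t|)}.
  by apply: continuous_subspaceT => t; exact: cvg_norm (cf t).
have [c _ cP] := EVT_max (ltW p0) cnf.
exists `|f c| => t; have [s sP ->//] := periodic_reduce 0 t p0.
by apply: cP; rewrite in_itv/= -[p]add0r.
Qed.

(** By uniqueness, two solutions with the same trajectory differ only by the
    choice of the initial time. *)
Lemma trajectory_reparametrization (R : realType) (X Y : {poly {poly R}})
    (x y x' y' : R -> R) (p : R) :
  solution X Y x y -> 0 < p -> periodic x p -> periodic y p ->
  solution X Y x' y' -> trajectory x' y' = trajectory x y ->
  exists t0, x' = (fun t => x (t0 + t)) /\ y' = (fun t => y (t0 + t)).
Proof.
move=> sol p0 xp yp sol' eqC.
have dx t := (sol t).1; have dy t := (sol t).2.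
have [Mx MxP] := periodic_bounded (is_derive_continuous dx) p0 xp.
have [My MyP] := periodic_bounded (is_derive_continuous dy) p0 yp.
pose M := Num.max Mx My.
have xM t : `|x t| <= M by rewrite le_max MxP.
have yM t : `|y t| <= M by rewrite le_max MyP orbT.
have inC t : exists s, x s = x' t /\ y s = y' t.
  have : trajectory x y (x' t, y' t) by rewrite -eqC; exists t.
  by move=> [s _ [xs ys]]; exists s.
have x'M t : `|x' t| <= M by have [s [<- _]] := inC t.
have y'M t : `|y' t| <= M by have [s [_ <-]] := inC t.
have [t0 [x0 y0]] := inC 0; exists t0.
apply: (bounded_solution_unique (M := M) sol' x'M y'M) => // [t||].
- by split; [exact: (is_derive_comp_shift _ dx)
            |exact: (is_derive_comp_shift _ dy)].
- by rewrite addr0.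
- by rewrite addr0.
Qed.

(** Compactness of a period interval makes the width of the tube uniform. *)
Lemma periodic_tube (R : realType) (x y : R -> R) (p : R) (U : set (R * R)) :
  continuous x -> continuous y -> 0 < p -> periodic x p -> periodic y p ->
  open U -> trajectory x y `<=` U ->
  exists2 e : R, 0 < e & forall t a b,
    `|a - x t| < e -> `|b - y t| < e -> U (a, b).
Proof.
move=> cx cy p0 xp yp oU CU.
pose inU (e t : R) := forall a b, `|a - x t| < e -> `|b - y t| < e -> U (a, b).
suff tube : \forall e \near (0 : R)^'+, `[0, p] `<=` inU e.
  near (0 : R)^'+ => e; exists e => // t.
  have [t' t'P fE] := periodic_reduce 0 t p0.
  rewrite (fE _ xp) (fE _ yp); apply: (near tube e) => //=.
  by rewrite in_itv/= -[p in X in _ && X]add0r.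
apply: (proj1 (compact_near_coveringP _) (@segment_compact _ 0 p)) => t _.
have /nbhs_ballP[d /= d0 dU] : nbhs (x t, y t) U.
  by apply: open_nbhs_nbhs; split=> //; apply: CU; exists t.
have d20 : 0 < d / 2 by rewrite divr_gt0.
near=> t' e => a b /= ax yb; apply: dU.
have xt : `|x t - x t'| < d / 2.
  by near: t'; have /cvgrPdist_lt := cx t; exact.
have yt : `|y t - y t'| < d / 2.
  by near: t'; have /cvgrPdist_lt := cy t; exact.
have ed : e < d / 2 by near: e; exact: nbhs_right_lt.
split; rewrite /ball /=.
  by have := ler_distD (x t') (x t) a; rewrite (distrC (x t') a); lra.
by have := ler_distD (y t') (y t) b; rewrite (distrC (y t') b); lra.
Unshelve. all: by end_near. Qed.

(** * Orbits of mirror-symmetric systems *)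

Lemma integral_curve_shift (R : realType) (I : Type)
    (f : I -> (I -> R) -> R) (z : I -> R -> R) (s : R) :
  integral_curve f z -> integral_curve f (fun i t => z i (s + t)).
Proof. by move=> zP i; exact: (is_derive_comp_shift _ (zP i)). Qed.

Definition mirror_symmetric (R : realType) (P Q : {poly {poly R}}) : Prop :=
  forall a b, P.[- a, b] = P.[a, b] /\ Q.[- a, b] = - Q.[a, b].

Lemma integral_curve_reversal (R : realType) (P Q : {poly {poly R}}) (M : R)
    (z : bool -> R -> R) :
  0 <= M -> mirror_symmetric P Q -> integral_curve (clamped_field M P Q) z ->
  integral_curve (clamped_field M P Q)
    (planar_curve (fun t => - z false (- t)) (fun t => z true (- t))).
Proof.
move=> M0 sym zP i t; case: i; rewrite /clamped_field /= clampN//.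
  rewrite (sym _ _).2; exact: (is_derive_comp_opp (zP true)).
rewrite (sym _ _).1 -[X in is_derive _ _ _ X]opprK.
have := is_derive_comp_opp (zP false) t; exact: is_deriveN.
Qed.

(** The reversed curve solves the same system with the same initial point. *)
Lemma integral_curve_parity (R : realType) (P Q : {poly {poly R}}) (M : R)
    (z : bool -> R -> R) :
  0 <= M -> mirror_symmetric P Q -> integral_curve (clamped_field M P Q) z ->
  z false 0 = 0 ->
  forall t, z false (- t) = - z false t /\ z true (- t) = z true t.
Proof.
move=> M0 sym zP z0 t.
have [L [B [L0 fL fB]]] := clamped_field_regular P Q M0.
have zrP := integral_curve_reversal M0 sym zP.
have eq0 i : z i 0 = planar_curve (fun t => - z false (- t))
    (fun t => z true (- t)) i 0 by case: i; rewrite /= oppr0 ?z0 ?oppr0.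
have zE := integral_curve_unique L0 fL fB zP zrP eq0.
split; last by rewrite [in RHS]zE.
by rewrite [in RHS]zE /= opprK.
Qed.

(** The composite of the reflections of time in 0 and in tau is the translation
    by 2 * tau. *)
Lemma two_crossings_periodic (R : realType) (P Q : {poly {poly R}}) (M tau : R)
    (z : bool -> R -> R) :
  0 <= M -> mirror_symmetric P Q -> integral_curve (clamped_field M P Q) z ->
  z false 0 = 0 -> z false tau = 0 -> forall i, periodic (z i) (2 * tau).
Proof.
move=> M0 sym zP z0 ztau i t.
have [odd0 even0] := integral_curve_parity M0 sym zP z0 t.
have w0 : z false (tau + 0) = 0 by rewrite addr0.
have [] := integral_curve_parity M0 sym (integral_curve_shift tau zP) w0 (- (tau + t)).
have -> : tau + - - (tau + t) = t + 2 * tau by ring.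
have -> : tau + - (tau + t) = - t by ring.
by case: i; rewrite ?odd0 ?even0 ?opprK.
Qed.

Section SymmetricOrbit.
Variables (R : realType) (P Q : {poly {poly R}}) (u v : R -> R) (p : R).
Hypotheses (sym : mirror_symmetric P Q) (sol : solution P Q u v).
Hypotheses (p0 : 0 < p) (up : periodic u p) (vp : periodic v p).
Hypothesis nonconst : exists t, (u t, v t) <> (u 0, v 0).
Hypothesis uN : forall t, u (- t) = - u t.

Let du := fun t => (sol t).1.
Let dv := fun t => (sol t).2.

Let u0 : u 0 = 0.
Proof. by have := uN 0; rewrite oppr0; lra. Qed.

Let bounded : exists2 M : R, 0 <= M & forall t, `|u t| <= M /\ `|v t| <= M.
Proof.
have [Mu MuP] := periodic_bounded (is_derive_continuous du) p0 up.
have [Mv MvP] := periodic_bounded (is_derive_continuous dv) p0 vp.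
exists (Num.max Mu Mv) => [|t]; last by rewrite !le_max MuP MvP orbT.
by rewrite le_max (le_trans (normr_ge0 _) (MuP 0)).
Qed.

(** On the axis the field is horizontal by symmetry.  It cannot vanish at a
    point of the orbit, because by uniqueness the orbit would be that point. *)
Lemma crossing_transversal t : u t = 0 -> P.[u t, v t] != 0.
Proof.
move=> ut0; apply/eqP => P0; case: nonconst => t'; apply.
have Q0 : Q.[u t, v t] = 0.
  by have := (sym 0 (v t)).2; rewrite ut0 oppr0; lra.
have [M M0 MP] := bounded.
have sol_shift : solution P Q (fun s => u (t + s)) (fun s => v (t + s)).
  by move=> s; split; [exact: (is_derive_comp_shift _ du)
                      |exact: (is_derive_comp_shift _ dv)].
have sol_cst : solution P Q (fun=> u t) (fun=> v t).
  by move=> s; rewrite P0 Q0; split; exact: is_derive_cst.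
have [ue ve] : (fun s => u (t + s)) = (fun=> u t) /\
    (fun s => v (t + s)) = (fun=> v t).
  apply: (bounded_solution_unique (M := M) sol_shift _ _ sol_cst) => [s|s|s|s||];
    rewrite ?addr0 ?(MP _).1 ?(MP _).2//.
have uE s : u s = u t by have := congr1 (fun f => f (s - t)) ue; rewrite /= subrKC.
have vE s : v s = v t by have := congr1 (fun f => f (s - t)) ve; rewrite /= subrKC.
by rewrite uE vE -(uE 0) -(vE 0).
Qed.

(** An orbit inside the axis would be constant, since the field is horizontal
    there.  The time can be moved to the first half of a period, because u is
    odd and vanishes at p / 2. *)
Lemma orbit_leaves_axis : exists2 t : R, 0 < t < p / 2 & u t != 0.
Proof.
have [t ut] : exists t, u t <> 0.
  apply: contrapT => /forallNP uall; have {}uall t : u t = 0.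
    by apply: contrapT; exact: uall.
  have dv0 (t : R) : is_derive t 1 v 0.
    have := dv t; suff -> : Q.[u t, v t] = 0 by [].
    by have := (sym 0 (v t)).2; rewrite uall oppr0; lra.
  case: nonconst => t; apply; rewrite !uall.
  by rewrite (is_derive_0_is_cst t 0 dv0).
have [s sP fE] := periodic_reduce (- (p / 2)) t p0.
have us : u s != 0 by apply/eqP; rewrite -fE.
have uh : u (p / 2) = 0.
  have := up (- (p / 2)); have -> : - (p / 2) + p = p / 2 by field.
  by rewrite uN; lra.
have abs_s : u `|s| != 0.
  by have [s0|s0] := leP 0 s; [rewrite ger0_norm|rewrite ltr0_norm// uN oppr_eq0].
exists `|s| => //; apply/andP; split.
  by rewrite normr_gt0; apply: contraNneq us => ->; rewrite u0.
rewrite lt_neqAle; apply/andP; split.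
  by apply: contraNneq abs_s => ->; rewrite uh.
by rewrite ler_norml; move: sP => /andP[? ?]; apply/andP; split; lra.
Qed.

(** The nearby curve starting on the axis crosses it again, because it follows
    the given one, which changes sides between t0 and p - t0. *)
Lemma nearby_symmetric_orbits (e : R) : 0 < e ->
  \forall s \near (0 : R), exists u' v' : R -> R,
    [/\ solution P Q u' v',
        exists2 p', 0 < p' & periodic u' p' /\ periodic v' p',
        exists t, (u' t, v' t) <> (u' 0, v' 0),
        forall t, exists t', `|u' t - u t'| < e /\ `|v' t - v t'| < e
      & u' 0 = 0 /\ v' 0 = v 0 + s].
Proof.
move=> e0.
have [t0 /andP[t00 t0h] ut0] := orbit_leaves_axis.
have [M M0 MP] := bounded.
pose M1 := M + 1; have M10 : 0 <= M1 by rewrite /M1; lra.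
have [L [B [L0 fL fB]]] := clamped_field_regular P Q M10.
have uM t : `|u t| <= M1 by have := (MP t).1; rewrite /M1; lra.
have vM t : `|v t| <= M1 by have := (MP t).2; rewrite /M1; lra.
have zP := (solution_clamped_field P Q uM vM).1 sol.
(* A distance below 1 keeps a curve in the box, where cutting off changes
   nothing; a distance below |u t0| keeps it on the same side of the axis. *)
pose d := Num.min e (Num.min 1 `|u t0|).
have d0 : 0 < d by rewrite !lt_min e0 ltr01 normr_gt0.
have [de [d1 du0]] : d <= e /\ d <= 1 /\ d <= `|u t0|.
  by rewrite /d !ge_min !lexx /= !orbT.
pose W := expR (2 * L * p).
have W0 : 0 < W by exact: expR_gt0.
near=> s.
have sW : 2 * `|s| * W < d.
  rewrite -ltr_pdivlMr// mulrC -ltr_pdivlMr//.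
  have : `|0 - s| < d / W / 2.
    by near: s; apply: (nbhsx_ballx (0 : R) (d / W / 2)); rewrite !divr_gt0.
  by rewrite sub0r normrN.
have [w wP w0] := integral_curve_exists
  (planar_curve (fun=> 0) (fun=> v 0 + s) ^~ 0) L0 fL fB.
have wz0 i : `|w i 0 - planar_curve u v i 0| <= `|s|.
  by rewrite w0; case: i => /=; rewrite ?u0 ?subrr ?normr0// addrC addKr.
have close i t : `|t| <= p -> `|w i t - planar_curve u v i t| < d.
  move=> tp; apply: le_lt_trans sW.
  apply: le_trans (integral_curve_dependence L0 fL fB wP zP wz0 i t) _.
  by rewrite ler_wpM2l ?mulr_ge0// ler_expR ler_wpM2l// mulr_ge0// ltW.
have opp_sides : u (p - t0) = - u t0 by rewrite addrC up uN.
have t0p : `|t0| <= p by rewrite ger0_norm; lra.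
have pt0p : `|p - t0| <= p by rewrite ger0_norm; lra.
have [tau tauP wtau] : exists2 tau, tau \in `[t0, p - t0] & w false tau = 0.
  apply: IVT; first lra.
    exact/continuous_subspaceT/(is_derive_continuous (wP false)).
  have := close false t0 t0p; have := close false (p - t0) pt0p.
  rewrite /= opp_sides ge_min le_max !ltr_norml.
  move: du0; have [u_ge0|u_lt0] := ger0P (u t0) => du0 h1 h2.
    by apply/andP; split; apply/orP; [right|left]; lra.
  by apply/andP; split; apply/orP; [left|right]; lra.
move: tauP; rewrite in_itv/= => /andP[t0tau taup].
have wper := two_crossings_periodic M10 sym wP (w0 false) wtau.
have tau20 : 0 < 2 * tau by lra.
have shadow t : exists t', forall i, `|w i t - planar_curve u v i t'| < d.
  have [t' t'P fE] := periodic_reduce (- tau) t tau20.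
  exists t' => i; rewrite (fE _ (wper i)); apply: close.
  by rewrite ler_norml; move: t'P => /andP[? ?]; apply/andP; split; lra.
have wM i t : `|w i t| <= M1.
  have [t' t'P] := shadow t; have := t'P i; have := MP t'.
  rewrite /M1; case: i => /=; rewrite ltr_norml !ler_norml; lra.
exists (w false), (w true); split.
- apply/(solution_clamped_field P Q (wM false) (wM true)).
  by move=> i; have := wP i; case: i.
- by exists (2 * tau).
- exists t0 => -[]; rewrite w0 /= => wt0 _.
  by have := close false t0 t0p; rewrite wt0 /= sub0r normrN; lra.
- move=> t; have [t' t'P] := shadow t; exists t'.
  by have := t'P false; have := t'P true; rewrite /=; lra.
- by rewrite !w0.
Unshelve. all: by end_near. Qed.

(** Transversality makes the crossings of the axis isolated, so by compactness
    of a period interval the orbit meets the axis near (0, v 0) only there. *)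
Lemma orbit_misses_nearby_axis_points :
  \forall s \near (0 : R)^', forall t, ~ (u t = 0 /\ v t = v 0 + s).
Proof.
suff miss : \forall s \near (0 : R)^',
    `[0, p] `<=` [set t | ~ (u t = 0 /\ v t = v 0 + s)].
  near=> s; move=> t; have [t' t'P fE] := periodic_reduce 0 t p0.
  rewrite (fE _ up) (fE _ vp); apply: (near miss s) => //=.
  by rewrite in_itv/= -[p in X in _ && X]add0r.
apply: (proj1 (compact_near_coveringP _) (@segment_compact _ 0 p) _ _
  (fun s t => ~ (u t = 0 /\ v t = v 0 + s))) => t _.
have cu := @is_derive_continuous _ _ _ du t.
have cv := @is_derive_continuous _ _ _ dv t.
have [ut0|ut0] := eqVneq (u t) 0; last first.
  have nu : \forall t' \near t, u t' != 0 by exact: cvgr_neq0 cu ut0.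
  near=> t' s => -[ut' _].
  have : u t' != 0 by near: t'; exact: nu.
  by rewrite ut' eqxx.
have [vt0|vt0] := eqVneq (v t) (v 0); last first.
  have d0 : 0 < `|v t - v 0| / 2 by rewrite divr_gt0// normr_gt0 subr_eq0.
  near=> t' s => -[_ vt'].
  have : `|v t - v t'| < `|v t - v 0| / 2.
    by near: t'; move/cvgrPdist_lt : cv; exact.
  have : `|0 - s| < `|v t - v 0| / 2.
    by near: s; apply: nbhs_dnbhs; exact: (nbhsx_ballx (0 : R) _ d0).
  have := ler_distD (v t') (v t) (v 0).
  by rewrite vt' sub0r normrN [v 0 + s - _]addrAC subrr add0r; lra.
have iso := isolated_value (du t) (crossing_transversal ut0).
near=> t' s => -[ut' vt'].
have tt' : u t' = u t -> t' = t by near: t'; exact: iso.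
have : s != 0 by near: s; exact: nbhs_dnbhs_neq.
have /addrI s0 : v 0 + s = v 0 + 0 by rewrite -vt' tt' ?vt0 ?addr0// ut' ut0.
by rewrite s0 eqxx.
Unshelve. all: by end_near. Qed.

End SymmetricOrbit.

(** The symmetric orbits through nearby points of the axis are closed, so a
    symmetric closed orbit is never isolated. *)
Lemma symmetric_orbit_not_isolated (R : realType) (P Q : {poly {poly R}})
    (u v : R -> R) (p e : R) :
  mirror_symmetric P Q -> solution P Q u v ->
  0 < p -> periodic u p -> periodic v p ->
  (exists t, (u t, v t) <> (u 0, v 0)) -> (forall t, u (- t) = - u t) ->
  0 < e ->
  exists u' v' : R -> R,
    [/\ solution P Q u' v',
        exists2 p', 0 < p' & periodic u' p' /\ periodic v' p',
        exists t, (u' t, v' t) <> (u' 0, v' 0),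
        forall t, exists t', `|u' t - u t'| < e /\ `|v' t - v t'| < e
      & forall t, (u t, v t) <> (u' 0, v' 0)].
Proof.
move=> sym sol p0 up vp nonconst uN e0.
have near_orbit := nearby_symmetric_orbits sym sol p0 up vp nonconst uN e0.
have miss := orbit_misses_nearby_axis_points sym sol p0 up vp nonconst.
have [s [sP [u' [v' [solS perS ncS closeS [u0 v0]]]]]] :=
  filter_ex (filterI miss (nbhs_dnbhs near_orbit)).
exists u', v'; split=> // t; rewrite u0 v0 => -[ut vt].
exact: sP (conj ut vt).
Qed.

(** * Reversible limit cycles *)

Lemma is_derive_unique (R : realType) (f : R -> R) (t a b : R) :
  is_derive t 1 f a -> is_derive t 1 f b -> a = b.
Proof. by move=> [_ <-] [_ <-]. Qed.

Lemma solution_affine (R : realType) (X Y : {poly {poly R}}) (x y : R -> R)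
    (a b c t : R) : solution X Y x y ->
  is_derive t 1 (fun t => a * x t + b * y t + c)
    (a * X.[x t, y t] + b * Y.[x t, y t]).
Proof.
move=> sol; have [dx dy] := sol t.
by apply: is_derive_eq; rewrite addr0.
Qed.

(** This follows by differentiating the two symmetry relations. *)
Lemma reversible_solution_defect (R : realType) (P Q : {poly {poly R}})
    (u v : R -> R) : solution P Q u v ->
  (forall t, u (- t) = - u t) -> (forall t, v (- t) = v t) ->
  forall t, P.[- u t, v t] = P.[u t, v t] /\ Q.[- u t, v t] = - Q.[u t, v t].
Proof.
move=> sol uN vN t; rewrite -(uN t) -(vN t).
have du t := (sol t).1; have dv t := (sol t).2.
have dur := is_derive_comp_opp du t; have dvr := is_derive_comp_opp dv t.
have uE : (fun t => u (- t)) = (fun t => - u t) by apply/funext.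
have vE : (fun t => v (- t)) = v by apply/funext.
rewrite uE in dur; rewrite vE in dvr.
have duN : is_derive t 1 (fun t => - u t) (- P.[u t, v t]).
  by have := du t; exact: is_deriveN.
split; rewrite [v (- t) in RHS]vN.
  exact: oppr_inj (is_derive_unique dur duN).
by rewrite (is_derive_unique (dv t) dvr) opprK.
Qed.

Theorem theorem1p1 (R : realType) (X Y : {poly {poly R}})
    (hX : vanishes_at_origin X) (hY : vanishes_at_origin Y)
    (C : set (R * R)) :
  limit_cycle X Y C -> star_like X Y C -> reversible X Y C ->
  algebraic_curve C.
Proof.
move=> [[x0 [y0 [sol0 [p p0 [x0p y0p]] nc0 CE0]]] [U [oU CU isolated]]] _.
move=> [x [y [[c1 c2] [phi [sol CE rev]]]]].
(* The reversible parametrization (x, y) is a time shift of the periodic one,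
   hence is itself periodic. *)
have [t0 [xE yE]] : exists t0, x = (fun t => x0 (t0 + t)) /\
    y = (fun t => y0 (t0 + t)).
  by apply: (trajectory_reparametrization sol0 p0 x0p y0p sol); rewrite -CE.
have xp : periodic x p by move=> t; rewrite xE addrA x0p.
have yp : periodic y p by move=> t; rewrite yE addrA y0p.
pose co := cos phi; pose si := sin phi.
have cs1 : co ^+ 2 + si ^+ 2 = 1 by exact: cos2Dsin2.
pose u t := co * x t + - si * y t + (co * c1 - si * c2).
pose v t := si * x t + co * y t + (si * c1 + co * c2).
have revE t : rotation phi (translation (c1, c2) (x t, y t)) = (u t, v t).
  by rewrite /rotation /translation /u /v /=; congr (_, _); rewrite -/co -/si; ring.
have uN t : u (- t) = - u t.
  by have := rev (- t); rewrite !revE opprK /= => -[].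
have vN t : v (- t) = v t.
  by have := rev (- t); rewrite !revE opprK /= => -[].
(* A and B recover (x, y) from (u, v), and (P, Q) is the field transported to
   the coordinates (u, v). *)
have [A AP] := horner2_affine co si (- c1).
have [B BP] := horner2_affine (- si) co (- c2).
have [X1 X1P] := horner2_comp X A B.
have [Y1 Y1P] := horner2_comp Y A B.
have [P PE] := horner2_combination co (- si) X1 Y1.
have [Q QE] := horner2_combination si co X1 Y1.
have ABuv t : A.[u t, v t] = x t /\ B.[u t, v t] = y t.
  rewrite AP BP /u /v.
  split; apply/eqP; rewrite -subr_eq0; apply/eqP.
    transitivity ((co ^+ 2 + si ^+ 2 - 1) * (x t + c1)); first by ring.
    by rewrite cs1 subrr mul0r.
  transitivity ((co ^+ 2 + si ^+ 2 - 1) * (y t + c2)); first by ring.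
  by rewrite cs1 subrr mul0r.
have suv : solution P Q u v.
  move=> t; rewrite PE QE !X1P !Y1P (ABuv t).1 (ABuv t).2.
  by split; exact: solution_affine.
have [DP DPE] : exists Z : {poly {poly R}}, forall a b,
    Z.[a, b] = P.[- a, b] - P.[a, b].
  have [N NE] := horner2_mirror P.
  have [Z ZE] := horner2_combination 1 (-1) N P.
  by exists Z => a b; rewrite ZE NE mul1r mulN1r.
have [DQ DQE] : exists Z : {poly {poly R}}, forall a b,
    Z.[a, b] = Q.[- a, b] + Q.[a, b].
  have [N NE] := horner2_mirror Q.
  have [Z ZE] := horner2_combination 1 1 N Q.
  by exists Z => a b; rewrite ZE NE !mul1r.
(* The symmetry defects of the new field, pulled back to the old coordinates. *)
have defect := reversible_solution_defect suv uN vN.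
have [m1 m1P] := horner2_affine co (- si) (co * c1 - si * c2).
have [m2 m2P] := horner2_affine si co (si * c1 + co * c2).
have [G1 G1P] := horner2_comp DP m1 m2.
have [G2 G2P] := horner2_comp DQ m1 m2.
have [G1z|G1nz] := eqVneq G1 0; last first.
  exists G1; split=> // q; rewrite CE => -[t _ <-] /=.
  by rewrite G1P m1P m2P DPE -/(u t) -/(v t) (defect t).1 subrr.
have [G2z|G2nz] := eqVneq G2 0; last first.
  exists G2; split=> // q; rewrite CE => -[t _ <-] /=.
  by rewrite G2P m1P m2P DQE -/(u t) -/(v t) (defect t).2 addNr.
(* Both defects vanish, so the field is symmetric and C is not isolated. *)
exfalso.
have mAB a b : m1.[A.[a, b], B.[a, b]] = a /\ m2.[A.[a, b], B.[a, b]] = b.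
  rewrite m1P m2P AP BP.
  split; apply/eqP; rewrite -subr_eq0; apply/eqP.
    transitivity ((co ^+ 2 + si ^+ 2 - 1) * a); first by ring.
    by rewrite cs1 subrr mul0r.
  transitivity ((co ^+ 2 + si ^+ 2 - 1) * b); first by ring.
  by rewrite cs1 subrr mul0r.
have sym : mirror_symmetric P Q.
  move=> a b; have := G1P A.[a, b] B.[a, b]; have := G2P A.[a, b] B.[a, b].
  rewrite G1z G2z !horner0 (mAB a b).1 (mAB a b).2 DPE DQE => h1 h2.
  by split; lra.
have [e e0 tube] : exists2 e : R, 0 < e & forall t a b,
    `|a - x t| < e -> `|b - y t| < e -> U (a, b).
  apply: (@periodic_tube _ x y p) => //; last by rewrite -CE.
    exact: is_derive_continuous (fun t => (sol t).1).
  exact: is_derive_continuous (fun t => (sol t).2).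
have up : periodic u p by move=> t; rewrite /u xp yp.
have vp : periodic v p by move=> t; rewrite /v xp yp.
have ncuv : exists t, (u t, v t) <> (u 0, v 0).
  apply: contrapT => /forallNP cuv.
  have {}cuv t : (u t, v t) = (u 0, v 0) by apply: contrapT; exact: cuv.
  have xy t : x t = x 0 /\ y t = y 0.
    have [<- <-] := ABuv t; have [<- <-] := ABuv 0.
    by have [-> ->] := cuv t.
  have xy0 t : x0 t = x 0 /\ y0 t = y 0.
    by have [<- <-] := xy (t - t0); rewrite xE yE subrKC.
  case: nc0 => t; apply.
  by have [-> ->] := xy0 t; have [-> ->] := xy0 0.
(* A rotation mixes two coordinate errors, each of which must be below e / 2. *)
have e20 : 0 < e / 2 by rewrite divr_gt0.
have [u' [v' [sol' [p' p'0 [u'p v'p]] nc' close' miss']]] :=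
  symmetric_orbit_not_isolated sym suv p0 up vp ncuv uN e20.
pose x' t := co * u' t + si * v' t - c1.
pose y' t := - si * u' t + co * v' t - c2.
have AB' t : A.[u' t, v' t] = x' t /\ B.[u' t, v' t] = y' t by rewrite AP BP.
have solxy' : solution X Y x' y'.
  move=> t.
  have := solution_affine co si (- c1) t sol'.
  have := solution_affine (- si) co (- c2) t sol'.
  rewrite !PE !QE !X1P !Y1P (AB' t).1 (AB' t).2 -/(x' _) -/(y' _).
  set Xt := X.[_, _]; set Yt := Y.[_, _] => dy' dx'.
  split.
    apply: (is_derive_eq dx').
    transitivity ((co ^+ 2 + si ^+ 2) * Xt); first by ring.
    by rewrite cs1 mul1r.
  apply: (is_derive_eq dy').
  transitivity ((co ^+ 2 + si ^+ 2) * Yt); first by ring.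
  by rewrite cs1 mul1r.
have uvE t s : x' t = x' s -> y' t = y' s -> u' t = u' s /\ v' t = v' s.
  move=> xx yy; have := mAB (u' t) (v' t); have := mAB (u' s) (v' s).
  by rewrite !(AB' _).1 !(AB' _).2 xx yy => -[<- <-] [<- <-].
have orbit' : periodic_orbit X Y (trajectory x' y').
  exists x', y'; split=> //.
    by exists p' => //; split=> t; rewrite /x' /y' u'p v'p.
  case: nc' => t nct; exists t => -[xx yy]; apply: nct.
  by have [-> ->] := uvE _ _ xx yy.
have sub' : trajectory x' y' `<=` U.
  move=> _ [t _ <-]; have [t' [ut vt]] := close' t.
  have co1 : `|co| <= 1 by exact: cos_max.
  have si1 : `|si| <= 1 by exact: sin_max.
  have comb (a b k l : R) : `|a| <= 1 -> `|b| <= 1 ->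
      `|k| < e / 2 -> `|l| < e / 2 -> `|a * k + b * l| < e.
    move=> a1 b1 ke le; apply: le_lt_trans (ler_normD _ _) _; rewrite !normrM.
    have := ler_pM (normr_ge0 a) (normr_ge0 k) a1 (lexx _).
    have := ler_pM (normr_ge0 b) (normr_ge0 l) b1 (lexx _).
    by lra.
  apply: (tube t'); rewrite -?(ABuv t').1 -?(ABuv t').2 ?AP ?BP.
    rewrite (_ : _ - _ = co * (u' t - u t') + si * (v' t - v t'));
      last by rewrite /x'; ring.
    exact: comb.
  rewrite (_ : _ - _ = - si * (u' t - u t') + co * (v' t - v t'));
    last by rewrite /y'; ring.
  by apply: comb => //; rewrite normrN.
have : trajectory x y (x' 0, y' 0).
  by rewrite -CE -(isolated _ orbit' sub'); exists 0.
case=> t _ [xx yy]; apply: (miss' t).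
have := mAB (u t) (v t); have := mAB (u' 0) (v' 0).
by rewrite (AB' 0).1 (AB' 0).2 (ABuv t).1 (ABuv t).2 xx yy => -[<- <-] [<- <-].
Qed.
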